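(* For every integer $k$ there is a position of \textsc{blocking pebbles} whose (normal-play combinatorial) game value is $k$.
   Context: \textsc{Blocking pebbles} is a two-player game between Left and Right. A position is a finite directed acyclic graph $G$ together with, at each vertex $v$, a triple $(b,r,g)$ of non-negative integers giving the numbers of blue, red and green pebbles on $v$. An in-neighbour of $v$ is a vertex $u$ with an arc $u\to v$; an out-neighbour is a vertex $w$ with an arc $v\to w$. On her turn Left chooses a vertex $v$ and either (1) moves a positive number of blue and/or green pebbles from $v$ to a single in-neighbour of $v$ (at no cost), or (2) removes two blue and/or green pebbles from $v$ and places one pebble (of one of the removed colours) on an out-neighbour of $v$. Blocking rule: no blue pebble may be moved onto a vertex that currently carries a non-zero number of red pebbles. Right has the symmetric moves with red and green pebbles, and no red pebble may be moved onto a vertex carrying a non-zero number of blue pebbles. Green pebbles are never blocked. Normal play: the player who makes the last move wins. Game values are in the sense of Conway's combinatorial game theory ($\{L\mid R\}$ notation, integers, nimbers $*n$). *)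

(* Defs.v *)
From HB Require Import structures.
From mathcomp Require Import all_boot all_order all_algebra.
From mathcomp Require Import zify.

Set Implicit Arguments.
Unset Strict Implicit.
Unset Printing Implicit Defensive.

Inductive game : Type :=
  Game (IL IR : Type) (GL : IL -> game) (GR : IR -> game).

(* Conway's order: G <= H iff no left option GL of G has H <= GL and no right
   option HR of H has HR <= G.  The roles of G and H are swapped in the
   recursive occurrences, so both directions are computed at once:
   cmp_game G H is the pair (G <= H, H <= G). *)
Fixpoint cmp_game (G : game) : game -> Prop * Prop :=
  match G with
  | Game IL IR GL GR =>
    fix cmp_G (H : game) : Prop * Prop :=
      match H with
      | Game JL JR HL HR =>
        ((forall i : IL, ~ (cmp_game (GL i) H).2) /\
         (forall j : JR, ~ (cmp_G (HR j)).2),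
         (forall j : JL, ~ (cmp_G (HL j)).1) /\
         (forall i : IR, ~ (cmp_game (GR i) H).1))
      end
  end.

Definition le_game (G H : game) : Prop := (cmp_game G H).1.
Definition eq_game (G H : game) : Prop := le_game G H /\ le_game H G.

Lemma cmp_game_sym (G H : game) :
  ((cmp_game G H).1 <-> (cmp_game H G).2) /\
  ((cmp_game G H).2 <-> (cmp_game H G).1).
Proof.
elim: G H => IL IR GL ihL GR ihR; elim=> JL JR HL jhL HR jhR.
split; split=> /= -[h1 h2]; split=> k hk.
- by apply: (h1 k); case: (ihL k (Game HL HR)) => _ [_]; apply.
- by apply: (h2 k); case: (jhR k) => _ [_]; apply.
- by apply: (h1 k); case: (ihL k (Game HL HR)) => _ [+ _]; apply.
- by apply: (h2 k); case: (jhR k) => _ [+ _]; apply.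
- by apply: (h1 k); case: (jhL k) => -[_ +] _; apply.
- by apply: (h2 k); case: (ihR k (Game HL HR)) => -[_ +] _; apply.
- by apply: (h1 k); case: (jhL k) => -[+ _] _; apply.
- by apply: (h2 k); case: (ihR k (Game HL HR)) => -[+ _] _; apply.
Qed.

Lemma le_gameE (IL IR JL JR : Type) (GL : IL -> game) (GR : IR -> game)
    (HL : JL -> game) (HR : JR -> game) :
  le_game (Game GL GR) (Game HL HR) <->
  (forall i, ~ le_game (Game HL HR) (GL i)) /\
  (forall j, ~ le_game (HR j) (Game GL GR)).
Proof.
rewrite {1}/le_game; split=> /= -[h1 h2]; split=> k hk.
- by apply: (h1 k); apply/(cmp_game_sym _ _).2.
- by apply: (h2 k); apply: (cmp_game_sym (HR k) (Game GL GR)).1.1 hk.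
- by apply: (h1 k); apply/(cmp_game_sym _ _).1.
- by apply: (h2 k); apply: (cmp_game_sym (Game GL GR) (HR k)).2.1 hk.
Qed.

Definition zero_game : game := Game (of_void game) (of_void game).

Fixpoint neg_game (G : game) : game :=
  match G with
  | Game IL IR GL GR =>
    Game (fun j : IR => neg_game (GR j)) (fun i : IL => neg_game (GL i))
  end.

Fixpoint nat_game (n : nat) : game :=
  match n with
  | 0 => zero_game
  | m.+1 => Game (fun _ : unit => nat_game m) (of_void game)
  end.

Definition int_game (k : int) : game :=
  match k with
  | Posz n => nat_game n
  | Negz n => neg_game (nat_game n.+1)
  end.

(* In mathcomp, [cycle e [::]] holds. *)
Record dag : Type := Dag {
  vertex :> finType;
  arc : rel vertex;
  arc_acyclic : forall c : seq vertex, c != [::] -> ~~ cycle arc c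
}.

(* The triple (b, r, g) of a vertex. *)
Notation pile := (nat * nat * nat)%type.

Definition blue (t : pile) : nat := t.1.1.
Definition red (t : pile) : nat := t.1.2.
Definition green (t : pile) : nat := t.2.

Variant player : Type := Left | Right.

Definition own (pl : player) (t : pile) : nat :=
  match pl with Left => blue t | Right => red t end.

Definition foe (pl : player) (t : pile) : nat :=
  match pl with Left => red t | Right => blue t end.

Definition put_pebbles (pl : player) (i j : nat) (t : pile) : pile :=
  match pl with
  | Left => (blue t + i, red t, green t + j)
  | Right => (blue t, red t + i, green t + j)
  end.

Definition take_pebbles (pl : player) (i j : nat) (t : pile) : pile :=
  match pl with
  | Left => (blue t - i, red t, green t - j)
  | Right => (blue t, red t - i, green t - j)
  end.

Section Moves.
Variable G : dag.
Implicit Types (c : {ffun G -> pile}) (pl : player).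

(* Take i own and j green pebbles off v; put i' own and j' green ones on w. *)
Definition transfer pl c (v w : G) (i j i' j' : nat) : {ffun G -> pile} :=
  [ffun x => if x == v then take_pebbles pl i j (c v)
             else if x == w then put_pebbles pl i' j' (c w) else c x].

Inductive move pl c : {ffun G -> pile} -> Prop :=
| MoveIn (v w : G) (i j : nat) of
    arc w v & 0 < i + j & i <= own pl (c v) & j <= green (c v)
    & (0 < i -> foe pl (c w) = 0) :
    move pl c (transfer pl c v w i j i j)
| MoveOut (v w : G) (i j i' j' : nat) of
    arc v w & i + j = 2 & i <= own pl (c v) & j <= green (c v)
    & i' + j' = 1 & i' <= i & j' <= j & (0 < i' -> foe pl (c w) = 0) :
    move pl c (transfer pl c v w i j i' j').

Definition option_of c' c : Prop := exists pl, move pl c c'.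

Definition ancestors (v : G) : nat := #|[set u | connect (@arc G) u v]|.
Definition pebble_count (t : pile) : nat := blue t + red t + green t.
(* Every move decreases this: moving in lowers the number of ancestors, and a
   pebble on any vertex weighs less than two pebbles on any other. *)
Definition weight c : nat := \sum_v pebble_count (c v) * (#|G| + ancestors v).

Lemma arc_irr (v w : G) : arc v w -> v != w.
Proof.
move=> a; apply/eqP=> e; rewrite -e in a.
by have := @arc_acyclic G [:: v] isT; rewrite /= a.
Qed.

Lemma ancestors_arc (v w : G) : arc v w -> ancestors v < ancestors w.
Proof.
move=> a; apply/proper_card/properP; split.
  by apply/subsetP=> u; rewrite !inE => /connect_trans; apply; exact: connect1.
exists w; rewrite !inE ?connect0 //; apply/negP=> /connectP[p pth e].
have := @arc_acyclic G (w :: p) isT.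
by rewrite /= rcons_path pth -e a.
Qed.

Lemma ancestors_gt0 (v : G) : 0 < ancestors v.
Proof. by apply/card_gt0P; exists v; rewrite inE connect0. Qed.

Lemma ancestors_le (v : G) : ancestors v <= #|G|.
Proof. exact: max_card. Qed.

Lemma weight_transfer pl c (v w : G) i j i' j' : v != w ->
  i <= own pl (c v) -> j <= green (c v) ->
  weight (transfer pl c v w i j i' j') + (i + j) * (#|G| + ancestors v)
  = weight c + (i' + j') * (#|G| + ancestors w).
Proof.
move=> nvw hi hj; have nwv : w != v by rewrite eq_sym.
rewrite /weight (bigD1 v) // (bigD1 w) //= [in RHS](bigD1 v) //.
rewrite [in RHS](bigD1 w) //= !ffunE eqxx (negPf nwv) eqxx.
rewrite (eq_bigr (fun x => pebble_count (c x) * (#|G| + ancestors x)));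
  last first.
  by move=> x /andP[/negPf xv /negPf xw]; rewrite ffunE xv xw.
have -> : pebble_count (c v) =
    pebble_count (take_pebbles pl i j (c v)) + (i + j).
  by case: pl hi hj => /=; rewrite /pebble_count /blue /red /green /=; lia.
have -> : pebble_count (put_pebbles pl i' j' (c w)) =
    pebble_count (c w) + (i' + j').
  by case: pl {hi} => /=; rewrite /pebble_count /blue /red /green /=; lia.
move: (pebble_count (take_pebbles _ _ _ _)) (pebble_count (c w)) => a b.
move: (_ + ancestors v) (_ + ancestors w) (\sum_(_ | _) _) => x y S.
by rewrite !mulnDl; lia.
Qed.

Lemma weight_move pl c c' : move pl c c' -> weight c' < weight c.
Proof.
case=> [v w i j a p hi hj _|v w i j i' j' a e hi hj e' _ _ _].
  have nvw : v != w by rewrite eq_sym; exact: arc_irr.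
  have := weight_transfer i j nvw hi hj.
  have lt_wv : (i + j) * (#|G| + ancestors w) < (i + j) * (#|G| + ancestors v).
    by rewrite ltn_pmul2l // ltn_add2l ancestors_arc.
  by move: lt_wv (weight c) (weight _); lia.
have := weight_transfer i' j' (arc_irr a) hi hj.
rewrite e e'; have := ancestors_le w; have := ancestors_gt0 v; lia.
Qed.

Lemma option_of_wf : well_founded option_of.
Proof.
move=> c; have [n lt_c] := ubnP (weight c).
elim: n c lt_c => [c|n ih c lt_c]; first by rewrite ltn0.
constructor=> c' [pl /weight_move lt_c'].
exact: (ih c' (leq_trans lt_c' lt_c)).
Qed.

Definition option_acc pl c (o : {c' | move pl c c'}) (a : Acc option_of c) :
    Acc option_of (sval o) :=
  Acc_inv a (ex_intro _ pl (svalP o)).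

Fixpoint pebble_game c (a : Acc option_of c) {struct a} : game :=
  Game (fun o : {c' | move Left c c'} => pebble_game (option_acc o a))
       (fun o : {c' | move Right c c'} => pebble_game (option_acc o a)).

End Moves.

Record position : Type := Position {
  board : dag;
  pebbles : {ffun board -> pile}
}.

Definition game_of (P : position) : game :=
  pebble_game (@option_of_wf (board P) (pebbles P)).

(* Main.v *)
(* A single pebble can never pay for an outward move, so at distance k
   from the source of a directed path it can only step inwards, k times in a row,
   and only its owner can move it: a lone blue pebble gives k, a lone red one gives -k. *)

Require Import Defs.
From mathcomp Require Import all_boot all_order all_algebra.
From mathcomp Require Import zify.

Set Implicit Arguments.
Unset Strict Implicit.
Unset Printing Implicit Defensive.

(** Unfolding a supposed [Game HL HR <= GL i] once denies [GL i <= HL j] for every [j]; right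
    options are dual. *)
Lemma le_game_options (IL IR JL JR : Type) (GL : IL -> game) (GR : IR -> game)
    (HL : JL -> game) (HR : JR -> game) :
  (forall i, exists j, le_game (GL i) (HL j)) ->
  (forall j, exists i, le_game (GR i) (HR j)) ->
  le_game (Game GL GR) (Game HL HR).
Proof.
move=> leL leR; apply/le_gameE; split=> k.
  have [j le_kj] := leL k; case eqk: (GL k) le_kj => [KL KR gL gR] le_kj.
  by move=> /le_gameE[/(_ j)].
have [i le_ik] := leR k; case eqk: (HR k) le_ik => [KL KR gL gR] le_ik.
by move=> /le_gameE[_ /(_ i)].
Qed.

(** Index types differ (legal moves against [unit] or [void]), so options are matched by value in
    both directions. *)
Lemma eq_game_options (IL IR JL JR : Type) (GL : IL -> game) (GR : IR -> game)
    (HL : JL -> game) (HR : JR -> game) :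
  (forall i, exists j, eq_game (GL i) (HL j)) ->
  (forall j, exists i, eq_game (GL i) (HL j)) ->
  (forall i, exists j, eq_game (GR i) (HR j)) ->
  (forall j, exists i, eq_game (GR i) (HR j)) ->
  eq_game (Game GL GR) (Game HL HR).
Proof.
move=> GHL HGL GHR HGR; split; apply: le_game_options => k.
- by have [j []] := GHL k; exists j.
- by have [i []] := HGR k; exists i.
- by have [i []] := HGL k; exists i.
- by have [j []] := GHR k; exists j.
Qed.

(** Arcs go up by one: vertex 0 is the source, and the number of a vertex is its distance from
    it. *)
Definition path_arc (n : nat) : rel 'I_n := fun u v => u.+1 == v.

(** Along a cycle the numbers would strictly increase from [x] back to [x]. *)
Lemma path_arc_acyclic (n : nat) (c : seq 'I_n) :
  c != [::] -> ~~ cycle (@path_arc n) c.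
Proof.
case: c => // x s _; apply/negP=> /= cyc.
have lt_path : path (relpre val ltn) x (rcons s x).
  by apply: sub_path cyc => u v /eqP /= <-.
have lt_tr : transitive (relpre val ltn : rel 'I_n).
  by move=> u v w; exact: ltn_trans.
have /allP/(_ x) := order_path_min lt_tr lt_path.
by rewrite mem_rcons inE eqxx /= ltnn => /(_ isT).
Qed.

Definition path_dag (n : nat) : dag := Dag (@path_arc_acyclic n).

Definition lone_pebble (n : nat) (pl : player) (v : path_dag n) :
    {ffun path_dag n -> pile} :=
  [ffun x => if x == v then put_pebbles pl 1 0 (0, 0, 0) else (0, 0, 0)].

Lemma move_lone_pebble (n : nat) (pl pl' : player) (v : path_dag n) c :
  move pl' (lone_pebble pl v) c ->
  pl' = pl /\ exists2 w : path_dag n, Defs.arc w v & c = lone_pebble pl w.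
Proof.
case=> [u w i j arc_wu ij_gt0 le_i le_j _|u w i j i' j' _ ij2 le_i le_j _ _ _ _];
  last first.
  (* An outward move takes two pebbles off [u], which holds at most one. *)
  move: le_i le_j; rewrite !ffunE; case: (u == v); case: pl; case: pl';
    by rewrite /= /blue /red /green /=; lia.
(* Something must be moved, and the only candidate is the pebble on [v], usable by its owner
   alone. *)
have [j0 i1 pl'E uE] : [/\ j = 0, i = 1, pl' = pl & u = v].
  move: le_i le_j; rewrite !ffunE; case: eqP => [->|_]; case: pl; case: pl';
    by rewrite /= /blue /red /green /=; try lia; split=> //; lia.
subst j i pl' u; split=> //; exists w => //; apply/ffunP=> x; rewrite !ffunE eqxx.
have /negPf wv := arc_irr arc_wu; rewrite wv.
by case: (eqVneq x v) => [->|_]; rewrite 1?[v == w]eq_sym ?wv; case: pl {le_i le_j};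
  case: (x == w).
Qed.

(** The target [w] is empty, so the blocking rule cannot interfere. *)
Lemma lone_pebble_step (n : nat) (pl : player) (v w : path_dag n) :
  Defs.arc w v -> move pl (lone_pebble pl v) (lone_pebble pl w).
Proof.
move=> arc_wv; have /negPf wv := arc_irr arc_wv.
have -> : lone_pebble pl w = transfer pl (lone_pebble pl v) v w 1 0 1 0.
  apply/ffunP=> x; rewrite !ffunE eqxx wv.
  by case: (eqVneq x v) => [->|_]; rewrite 1?[v == w]eq_sym ?wv; case: pl;
    case: (x == w).
by apply: MoveIn => //; rewrite !ffunE ?eqxx ?wv; case: pl.
Qed.

Definition signed_game (pl : player) (n : nat) : game :=
  match pl with Left => nat_game n | Right => neg_game (nat_game n) end.

(** The accessibility proof [a] is arbitrary, since options of [pebble_game] carry proofs built by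
    [option_acc]. *)
Lemma pebble_game_lone (n : nat) (pl : player) (m : nat) (v : path_dag n)
    (a : Acc (@option_of (path_dag n)) (lone_pebble pl v)) :
  v = m :> nat -> eq_game (pebble_game a) (signed_game pl m).
Proof.
elim: m v a => [|m IHm] v a vm.
  have stuck pl' c : ~ move pl' (lone_pebble pl v) c.
    by move=> /move_lone_pebble[_ [w /eqP]]; rewrite vm.
  by case: a => a; case: pl a stuck => a stuck; apply: eq_game_options;
    case=> // c mv; case: (stuck _ _ mv).
have pred_lt : m < n by rewrite ltnW // -vm ltn_ord.
have [w wm] : exists w : path_dag n, w = m :> nat by exists (Ordinal pred_lt).
have step : move pl (lone_pebble pl v) (lone_pebble pl w).
  by apply: lone_pebble_step; rewrite /= /path_arc wm vm.
have only pl' c : move pl' (lone_pebble pl v) c -> pl' = pl /\ c = lone_pebble pl w.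
  move=> /move_lone_pebble[-> [w' /eqP arc_w' ->]]; split=> //.
  by congr lone_pebble; apply: val_inj; move: arc_w'; rewrite /= wm vm => -[].
(* Destructing [a] lets the fixpoint [pebble_game] unfold; the four matching conditions follow for
   Left, then for Right. *)
have {IHm} IH := IHm w; case: a => a; case: pl a step only IH => a step only IH;
  apply: eq_game_options.
- case=> c mv; exists tt; case: (only _ _ mv) => _ cw.
  by subst c; apply: IH.
- by case; exists (exist _ _ step); apply: IH.
- by case=> c mv; case: (only _ _ mv).
- by case.
- by case=> c mv; case: (only _ _ mv).
- by case.
- case=> c mv; exists tt; case: (only _ _ mv) => _ cw.
  by subst c; apply: IH.
- by case; exists (exist _ _ step); apply: IH.
Qed.

Theorem theorem1 (k : int) :
  exists P : position, eq_game (game_of P) (int_game k).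
Proof.
have lone pl n : exists P, eq_game (game_of P) (signed_game pl n).
  (* With [n.+1] vertices, the last one has number [n]. *)
  exists (@Position (path_dag n.+1) (lone_pebble pl (ord_max : 'I_n.+1))).
  exact: pebble_game_lone.
(* [Negz n] stands for [-(n + 1)], hence the distance [n.+1]. *)
by case: k => n; [apply: (lone Left) | apply: (lone Right n.+1)].
Qed.
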